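(* Suppose Assumptions 1, 2, 3 and 4 (stated in the context) hold, and let $\beta\ge L_3$. Let $x$ be the state (a solution) of $$\dot x=Ax+B\omega+f_1(x,u)+f_2(x,u)\theta(t),\qquad \omega\in-\mathcal{F}(Cx),\qquad y=Fx,$$ and let $\tilde x$ be the state (a solution) of the sliding mode observer $$\dot{\tilde x}\in A\tilde x+B\tilde\omega-Le_y+f_1(\tilde x,u)-\beta P^{-1}F^T\|h(\tilde x,u)\|\,\mathrm{Sign}(e_y),\qquad \tilde\omega\in-\mathcal{F}(C\tilde x-Ke_y),\qquad \tilde y=F\tilde x,$$ where $e_y=\tilde y-y=F(\tilde x-x)$. Then the observer state $\tilde x$ converges exponentially to the original state $x$, i.e. there exist constants $M\ge 0$ and $c>0$ such that $\|\tilde x(t)-x(t)\|\le Me^{-ct}$ for all $t\ge0$.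
   Context: Data: $A\in\mathbb{R}^{n\times n}$, $B\in\mathbb{R}^{n\times m}$, $C\in\mathbb{R}^{m\times n}$, $F\in\mathbb{R}^{p\times n}$ are given matrices; $x\in\mathbb{R}^n$ is the state, $u\in\mathbb{R}^r$ the control input, $y\in\mathbb{R}^p$ the measurable output; $\mathcal{F}:\mathbb{R}^m\rightrightarrows\mathbb{R}^m$ is a set-valued map; $f_1:\mathbb{R}^n\times\mathbb{R}^r\to\mathbb{R}^n$ and $f_2:\mathbb{R}^n\times\mathbb{R}^r\to\mathbb{R}^{n\times l}$ are known functions; $\theta(t)\in\mathbb{R}^l$ is unknown. Norms are Euclidean (and the induced operator norms for matrices). A square matrix $P$ is called positive definite, written $P>0$, if there is $a>0$ with $\langle Px,x\rangle\ge a\|x\|^2$ for all $x$. Assumption 1: $\mathcal{F}$ is monotone (i.e. $\langle x^*-y^*,x-y\rangle\ge0$ whenever $x^*\in\mathcal{F}(x)$, $y^*\in\mathcal{F}(y)$) and upper semi-continuous with non-empty, closed, convex and bounded values. Assumption 2: $f_1,f_2$ are continuous and Lipschitz in $x$: there are $L_1>0$, $L_2>0$ such that for all $x_1,x_2\in\mathbb{R}^n$, $u\in\mathbb{R}^r$, $\|f_1(x_1,u)-f_1(x_2,u)\|\le L_1\|x_1-x_2\|$ and $\|f_2(x_1,u)-f_2(x_2,u)\|\le L_2\|x_1-x_2\|$. Assumption 3: $\theta$ is continuous and bounded by some $L_3>0$, i.e. $\|\theta(t)\|\le L_3$ for all $t$. Assumption 4: With $\gamma=L_1+L_2L_3$,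 there exist $\epsilon>0$, $P\in\mathbb{R}^{n\times n}$ with $P>0$, $L\in\mathbb{R}^{n\times p}$, $K\in\mathbb{R}^{m\times p}$ and a matrix function $h:\mathbb{R}^n\times\mathbb{R}^r\to\mathbb{R}^{l\times p}$ such that $P(A-LF)+(A-LF)^TP+\gamma P^2+\gamma I+\epsilon I\le0$ (negative semidefinite), $B^TP=C-KF$, and $f_2(x,u)^TP=h(x,u)F$ for all $(x,u)$. These $P,L,K,h$ are the ones used in the observer. Set-valued sign: $\mathrm{Sign}(v)=v/\|v\|$ if $v\ne0$, and $\mathrm{Sign}(0)$ is the unit ball. Solutions are absolutely continuous functions of time on $[0,+\infty)$ satisfying the system for almost every $t$, with selections $\omega(t)$, resp. $\tilde\omega(t)$, from the indicated sets.
   Formalization: The formal theorem additionally requires the matrix P in Assumption 4 to be symmetric; with P>0 meaning only coercivity of the quadratic form, the claim fails (e.g. F=B=C=0, f1=f2=0, A=I, P=[1,-2;2,1], gamma=epsilon=2, where the error satisfies e'=e). *)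

(* Defs.v *)
From HB Require Import structures.
From mathcomp Require Import all_boot all_order all_algebra.
From mathcomp Require Import all_classical all_reals all_analysis.

Set Implicit Arguments.
Unset Strict Implicit.
Unset Printing Implicit Defensive.

Import Order.TTheory GRing.Theory Num.Theory.
Import numFieldNormedType.Exports.

Local Open Scope classical_set_scope.
Local Open Scope ring_scope.

Definition dotv (R : realType) n (v w : 'cV[R]_n) : R :=
  \sum_(i < n) v i 0 * w i 0.

(* Euclidean norm and induced operator norm: `|v| on matrices is the sup norm. *)
Definition enorm (R : realType) n (v : 'cV[R]_n) : R := Num.sqrt (dotv v v).

Definition opnorm (R : realType) m n (A : 'M[R]_(m, n)) : R :=
  sup [set enorm (A *m v) | v in [set v : 'cV[R]_n | enorm v <= 1]].

(* Symmetry is not part of this definition. *)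
Definition posdefmx (R : realType) n (P : 'M[R]_n) : Prop :=
  exists2 a : R, 0 < a & forall v, a * enorm v ^+ 2 <= dotv (P *m v) v.

Definition negsemidefmx (R : realType) n (N : 'M[R]_n) : Prop :=
  forall v, dotv (N *m v) v <= 0.

Definition monotone_map (R : realType) m (G : 'cV[R]_m -> set 'cV[R]_m) : Prop :=
  forall v w v' w', G v v' -> G w w' -> 0 <= dotv (v' - w') (v - w).

Definition upper_semicontinuous (T U : topologicalType) (G : T -> set U) : Prop :=
  forall v (V : set U), open V -> G v `<=` V -> \forall w \near v, G w `<=` V.

Definition Sign (R : realType) p (v : 'cV[R]_p) : set 'cV[R]_p :=
  if v == 0 then [set s | enorm s <= 1] else [set (enorm v)^-1 *: v].

(* The families ]a i, b i[, i < k, range over the finite families of pairwise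
   disjoint subintervals of [t0, t1]. *)
Definition abs_continuous_on (R : realType) n (t0 t1 : R) (f : R -> 'cV[R]_n) :
    Prop :=
  forall e : R, 0 < e -> exists2 d : R, 0 < d &
    forall k (a b : 'I_k -> R),
      (forall i, [/\ t0 <= a i, a i <= b i & b i <= t1]) ->
      (forall i j, i != j -> b i <= a j \/ b j <= a i) ->
      \sum_(i < k) (b i - a i) < d ->
      \sum_(i < k) enorm (f (b i) - f (a i)) < e.

(* Absolute continuity on the unbounded interval [0, +oo[ is, as usual for
   solutions of differential inclusions, meant on each compact subinterval. *)
Definition abs_continuous_half_line (R : realType) n (f : R -> 'cV[R]_n) : Prop :=
  forall t : R, 0 < t -> abs_continuous_on 0 t f.

Definition assumption1 (R : realType) m (FF : 'cV[R]_m -> set 'cV[R]_m) : Prop :=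
  [/\ monotone_map FF, upper_semicontinuous FF &
      forall v, [/\ FF v !=set0, closed (FF v), convex_set (FF v) &
                    bounded_set (FF v)]].

Definition assumption2 (R : realType) n r l
    (f1 : 'cV[R]_n -> 'cV[R]_r -> 'cV[R]_n)
    (f2 : 'cV[R]_n -> 'cV[R]_r -> 'M[R]_(n, l)) (L1 L2 : R) : Prop :=
  [/\ continuous (fun z : 'cV[R]_n * 'cV[R]_r => f1 z.1 z.2),
      continuous (fun z : 'cV[R]_n * 'cV[R]_r => f2 z.1 z.2),
      0 < L1, 0 < L2 &
      forall x1 x2 u,
        enorm (f1 x1 u - f1 x2 u) <= L1 * enorm (x1 - x2) /\
        opnorm (f2 x1 u - f2 x2 u) <= L2 * enorm (x1 - x2)].

Definition assumption3 (R : realType) l (theta : R -> 'cV[R]_l) (L3 : R) : Prop :=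
  [/\ {within `[0, +oo[, continuous theta}, 0 < L3 &
      forall t, 0 <= t -> enorm (theta t) <= L3].

(* "P > 0" in a matrix inequality refers to a symmetric P.  Here P^T = P cannot
   be dropped: for n = 2, F = 0, B = C = 0, f1 = 0, f2 = 0, gamma = 2,
   P = [1, -2; 2, 1] and A = I, the remaining conditions hold with eps = 2
   (the quadratic form vanishes identically), but the
   estimation error obeys e' = e. *)
Definition assumption4 (R : realType) n m p r l
    (A : 'M[R]_n) (B : 'M[R]_(n, m)) (C : 'M[R]_(m, n)) (F : 'M[R]_(p, n))
    (f2 : 'cV[R]_n -> 'cV[R]_r -> 'M[R]_(n, l)) (gamma eps : R)
    (P : 'M[R]_n) (L : 'M[R]_(n, p)) (K : 'M[R]_(m, p))
    (h : 'cV[R]_n -> 'cV[R]_r -> 'M[R]_(l, p)) : Prop :=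
  [/\ 0 < eps,
      P^T = P /\ posdefmx P,
      negsemidefmx (P *m (A - L *m F) + (A - L *m F)^T *m P
                    + gamma *: (P *m P) + gamma%:M + eps%:M),
      B^T *m P = C - K *m F &
      forall x u, (f2 x u)^T *m P = h x u *m F].

Definition plant_solution (R : realType) n m r l
    (A : 'M[R]_n) (B : 'M[R]_(n, m)) (C : 'M[R]_(m, n))
    (FF : 'cV[R]_m -> set 'cV[R]_m)
    (f1 : 'cV[R]_n -> 'cV[R]_r -> 'cV[R]_n)
    (f2 : 'cV[R]_n -> 'cV[R]_r -> 'M[R]_(n, l))
    (theta : R -> 'cV[R]_l) (u : R -> 'cV[R]_r) (x : R -> 'cV[R]_n) : Prop :=
  abs_continuous_half_line x /\
  exists omega : R -> 'cV[R]_m,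
    {ae lebesgue_measure, forall t : R, 0 <= t ->
      (-%R @` FF (C *m x t)) (omega t) /\
      is_derive t 1 x (A *m x t + B *m omega t + f1 (x t) (u t)
                       + f2 (x t) (u t) *m theta t)}.

Definition observer_solution (R : realType) n m p r l
    (A : 'M[R]_n) (B : 'M[R]_(n, m)) (C : 'M[R]_(m, n)) (F : 'M[R]_(p, n))
    (FF : 'cV[R]_m -> set 'cV[R]_m)
    (f1 : 'cV[R]_n -> 'cV[R]_r -> 'cV[R]_n)
    (P : 'M[R]_n) (L : 'M[R]_(n, p)) (K : 'M[R]_(m, p))
    (h : 'cV[R]_n -> 'cV[R]_r -> 'M[R]_(l, p)) (beta : R)
    (u : R -> 'cV[R]_r) (y : R -> 'cV[R]_p) (xo : R -> 'cV[R]_n) : Prop :=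
  let ey t := F *m xo t - y t in
  abs_continuous_half_line xo /\
  exists (omega : R -> 'cV[R]_m) (s : R -> 'cV[R]_p),
    {ae lebesgue_measure, forall t : R, 0 <= t ->
      [/\ (-%R @` FF (C *m xo t - K *m ey t)) (omega t),
          Sign (ey t) (s t) &
          is_derive t 1 xo
            (A *m xo t + B *m omega t - L *m ey t + f1 (xo t) (u t)
             - (beta * opnorm (h (xo t) (u t))) *: (invmx P *m F^T *m s t))]}.

(* Main.v *)
(* With e = xo - x, the function V = <Pe, e> is a Lyapunov function.  Since
   B^T P = C - K F, the set-valued terms contribute a nonpositive amount to V' by
   monotonicity; since f2^T P = h F, the unknown input contributes at most
   2 L3 |h(xo, u)| |Fe|, which the sliding term -2 beta |h(xo, u)| |Fe| absorbs; the
   Lipschitz terms are at most gamma (|Pe|^2 + |e|^2).  The matrix inequality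
   then gives V' <= - eps |e|^2 <= - c V almost everywhere, and exp(c t) V is
   absolutely continuous with an almost everywhere nonpositive derivative, hence
   nonincreasing. *)
Require Import Defs.
From HB Require Import structures.
From mathcomp Require Import all_boot all_order all_algebra.
From mathcomp Require Import all_classical all_reals all_analysis.
From mathcomp Require Import ring lra.
Import Order.TTheory GRing.Theory Num.Theory.
Import numFieldNormedType.Exports.
Set Implicit Arguments.
Unset Strict Implicit.
Unset Printing Implicit Defensive.
Local Open Scope classical_set_scope.
Local Open Scope ring_scope.

(** * Monotonicity of absolutely continuous functions *)

(* Real induction, in the spirit of Cousin's lemma: the supremum of the
   points reached from a is reached and cannot lie strictly before b. *)
Lemma straddle_ind (R : realType) (Q : R -> R -> Prop) (a b : R) :
  a <= b ->
  (forall x y z, a <= x -> x <= y -> y <= z -> z <= b ->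
    Q x y -> Q y z -> Q x z) ->
  (forall s, a <= s -> s <= b -> exists2 r, 0 < r &
    forall x y, a <= x -> x <= s -> s <= y -> y <= b ->
      s - r < x -> y < s + r -> Q x y) ->
  Q a b.
Proof.
move=> ab Qtrans Qloc.
pose S := [set s | [/\ a <= s, s <= b & Q a s]].
have Sa : S a.
  split=> //; have [r r0] := Qloc a (lexx a) ab.
  by apply=> //; lra.
have hS : has_sup S by split; [exists a | exists b => s []].
have aS : a <= sup S by apply: (ub_le_sup hS.2).
have Sb : sup S <= b by apply: ge_sup; [exists a | move=> s []].
have [r r0 Qr] := Qloc _ aS Sb.
have [x [ax xb Qax] rx] := sup_adherent r0 hS.
have xS : x <= sup S by apply: (ub_le_sup hS.2).
(* [Qloc] at [sup S] links [x] to [y], which lies past the supremum unless it equals [b]; as [y]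
   turns out to be in [S], it must be [b]. *)
pose y := Num.min b (sup S + r / 2).
have Sy : sup S <= y by rewrite le_min Sb/=; lra.
have yb : y <= b by rewrite ge_min lexx.
have Qay : Q a y.
  apply: (Qtrans a x y) => //; first exact: le_trans Sy.
  by apply: Qr => //; rewrite /y gt_min; apply/orP; right; lra.
have {}Sy : y <= sup S by apply: (ub_le_sup hS.2); split=> //; lra.
suff <- : y = b by [].
apply/eqP; rewrite eq_le yb/= leNgt; apply/negP => yltb.
move: Sy yltb; rewrite /y; case: (leP b (sup S + r / 2)); lra.
Qed.

(** The intervals are unordered and may be degenerate, so that two families can be concatenated
    without sorting or discarding anything. *)
Definition itv_family (R : realType) (a b : R) k (s t : 'I_k -> R) : Prop :=
  (forall i, [/\ a <= s i, s i <= t i & t i <= b]) /\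
  (forall i j, i != j -> t i <= s j \/ t j <= s i).

Lemma itv_family_cat (R : realType) (a b c : R) k l
    (s t : 'I_k -> R) (s' t' : 'I_l -> R) :
  a <= b -> b <= c -> itv_family a b s t -> itv_family b c s' t' ->
  itv_family a c
    (fun i => match fintype.split i with inl j => s j | inr j => s' j end)
    (fun i => match fintype.split i with inl j => t j | inr j => t' j end).
Proof.
move=> ab bc [st dst] [st' dst']; split.
  move=> i; case: fintype.splitP => j _.
    by case: (st j) => ? ? tb; split=> //; exact: le_trans bc.
  by case: (st' j) => bs ? ?; split=> //; exact: le_trans bs.
move=> i j ij; case: (fintype.splitP i) => i' ii'; case: (fintype.splitP j) => j' jj'.
- by apply: dst; apply: contraNneq ij => e; apply/eqP/val_inj; rewrite /= ii' jj' e.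
- by left; have [_ _ tb] := st i'; have [bs _ _] := st' j'; exact: le_trans bs.
- by right; have [_ _ tb] := st j'; have [bs _ _] := st' i'; exact: le_trans bs.
- by apply: dst'; apply: contraNneq ij => e; apply/eqP/val_inj; rewrite /= ii' jj' e.
Qed.

Lemma sum_split_ord (R : realType) (f : R -> R -> R) k l
    (s t : 'I_k -> R) (s' t' : 'I_l -> R) :
  \sum_(i < k + l)
    f (match fintype.split i with inl j => s j | inr j => s' j end)
      (match fintype.split i with inl j => t j | inr j => t' j end) =
  \sum_(i < k) f (s i) (t i) + \sum_(i < l) f (s' i) (t' i).
Proof.
rewrite big_split_ord/=; congr (_ + _); apply: eq_bigr => i _.
  by rewrite (unsplitK (inl i)).
by rewrite (unsplitK (inr i)).
Qed.

Definition abs_continuous_real (R : realType) (a b : R) (g : R -> R) : Prop :=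
  forall e : R, 0 < e -> exists2 d : R, 0 < d &
    forall k (s t : 'I_k -> R), itv_family a b s t ->
      \sum_(i < k) (t i - s i) < d ->
      \sum_(i < k) `|g (t i) - g (s i)| < e.

(** Carathéodory's slope [q] is continuous at [s] and [q s = d < e]. As [x] and [y] lie on either
    side of [s], the increment splits at [s] into two pieces of slope below [e]. *)
Lemma is_derive_le0_straddle (R : realType) (g : R -> R) (s d e : R) :
  is_derive s 1 g d -> d <= 0 -> 0 < e -> exists2 r, 0 < r &
    forall x y, x <= s -> s <= y -> s - r < x -> y < s + r ->
      g y - g x <= e * (y - x).
Proof.
move=> /is_derive1_caratheodory[q [gq cq qs]] d0 e0.
have : \forall z \near s, q z < e.
  have qe : q s < e by rewrite qs; exact: le_lt_trans e0.
  exact: (cvgr_lt (q s) cq).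
move=> /nbhs_ballP[r /= r0 Hr]; exists r => // x y xs sy rx ry.
have qx : q x < e by apply: Hr; rewrite /ball/= ger0_norm; lra.
have qy : q y < e by apply: Hr; rewrite /ball/= ler0_norm; lra.
have -> : g y - g x = q y * (y - s) + q x * (s - x).
  by have := gq y; have := gq x; lra.
have -> : e * (y - x) = e * (y - s) + e * (s - x) by ring.
by rewrite lerD// ler_wpM2r//; lra.
Qed.

Lemma negligible_open_cover (R : realType) (N : set R) (d : R) :
  (@lebesgue_measure R).-negligible N -> 0 < d ->
  exists U : set R, [/\ open U, N `<=` U & (lebesgue_measure U < d%:E)%E].
Proof.
move=> [N' [mN' N'0 NN']] d0.
have [||//|U [oU N'U Ud]] := @lebesgue_regularity_outer R N' d; first exact: mN'.
  by apply: (le_lt_trans (y := 0%E)); [rewrite -N'0 | exact: ltry].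
exists U; split=> //; first exact: subset_trans N'U.
have mU : measurable (U : set (measurableTypeR R)).
  exact: measurable_realfun.open_measurable.
(* Outer regularity bounds only the part of [U] outside [N']; the remaining part lies in the null
   set [N']. *)
rewrite (measureDI lebesgue_measure mU mN').
rewrite [X in (_ + X)%E](_ : _ = 0%E) ?adde0//.
apply/eqP; rewrite -measure_le0 -N'0; apply: le_measure; rewrite ?inE//.
exact: measurableI.
Qed.

(* The exceptional null set is covered by an open set U of small measure.  Off U
   the increments of g grow at slope at most e; inside U they are charged to
   intervals of total length at most the measure of U, hence are small by
   absolute continuity. *)
Lemma ac_nonincreasing (R : realType) (a b : R) (g : R -> R) :
  a <= b -> abs_continuous_real a b g ->
  {ae lebesgue_measure, forall t : R, a <= t -> t <= b ->
    exists2 d, is_derive t 1 g d & d <= 0} ->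
  g b <= g a.
Proof.
move=> ab acg aeg.
suff H e : 0 < e -> g b - g a <= e * (b - a) + e.
  rewrite leNgt; apply/negP => gab.
  have ba : 0 < b - a + 1 by lra.
  (* With this [e] the bound [e * (b - a) + e] is half of [g b - g a], which is absurd. *)
  have := H ((g b - g a) / 2 / (b - a + 1)).
  rewrite !divr_gt0// ?subr_gt0// => /(_ isT).
  by rewrite -[X in _ <= _ + X]mulr1 -mulrDr divfK ?gt_eqF//; lra.
move=> e0; have [d d0 Hd] := acg e e0.
have [U [oU NU Ud]] := negligible_open_cover aeg d0.
have mU : measurable (U : set (measurableTypeR R)).
  exact: measurable_realfun.open_measurable.
(* The increment is bounded by slope [e] plus the variation over a family whose length is charged to
   [U]. Half-open intervals make these charges add up exactly under concatenation. *)
pose Q x y := exists k (s t : 'I_k -> R), [/\ itv_family x y s t,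
  ((\sum_(i < k) (t i - s i))%:E <= lebesgue_measure (U `&` `[x, y[))%E &
  g y - g x <= e * (y - x) + \sum_(i < k) `|g (t i) - g (s i)|].
suff [k [s [t [fst lst gst]]]] : Q a b.
  apply: (le_trans gst); rewrite lerD2l ltW//; apply: Hd => //.
  rewrite -lte_fin; apply: (le_lt_trans lst); apply: le_lt_trans Ud.
  by apply: le_measure; rewrite ?inE//; apply: measurableI.
apply: straddle_ind => //.
- move=> x y z _ xy yz _ [k [s [t [fst lst gst]]]] [l [s' [t' [fst' lst' gst']]]].
  do 3!eexists; split; first exact: (itv_family_cat xy yz fst fst').
    rewrite (sum_split_ord (fun u v => v - u)) EFinD.
    have -> : `[x, z[%classic = `[x, y[ `|` `[y, z[ :> set R.
      by rewrite -itv_bndbnd_setU// bnd_simp.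
    rewrite setIUr measureU//=; first exact: leeD.
    + exact: measurableI.
    + exact: measurableI.
    + rewrite -subset0 => w [[_ /=]]; rewrite in_itv/= => /andP[_ wy] [_].
      by rewrite /= in_itv/= leNgt wy.
  rewrite (sum_split_ord (fun u v => `|g v - g u|)).
  by move: gst gst'; rewrite !mulrBr; lra.
(* Near a point of [U] the family is the single interval from [x] to [y], contained in [U]; near a
   point off [U], where the derivative exists and is nonpositive, it is empty. *)
- move=> s as_ sb; case: (pselect (U s)) => [Us|nUs].
    have /nbhs_ballP[r /= r0 rU] : nbhs s U by exact: open_nbhs_nbhs.
    exists r => // x y ax xs sy yb rx ry.
    exists 1%N, (fun=> x), (fun=> y); rewrite !big_ord1; split.
    + split; first by move=> _; split=> //; lra.
      by move=> i j; rewrite !ord1 eqxx.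
    + have -> : U `&` `[x, y[ = `[x, y[%classic.
        apply/setIidPr => z /=; rewrite in_itv/= => /andP[xz zy]; apply: rU.
        by rewrite /ball/= ltr_norml; apply/andP; split; lra.
      rewrite lebesgue_measure_itv/= lte_fin; case: ltP => // yx.
      by rewrite lee_fin; lra.
    + by rewrite (le_trans (ler_norm _))// lerDr mulr_ge0//; lra.
  have [c gs c0] : exists2 d, is_derive s 1 g d & d <= 0.
    by apply: contrapT => ns; apply: nUs; apply: NU => /= /(_ as_ sb).
  have [r r0 Hr] := is_derive_le0_straddle gs c0 e0.
  exists r => // x y ax xs sy yb rx ry.
  have f0 : 'I_0 -> R by case.
  exists 0%N, f0, f0; rewrite !big_ord0; split.
  + by split; case.
  + exact: measure_ge0.
  + by rewrite addr0; exact: Hr.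
Qed.

(** * Euclidean inner product, norm and operator norm *)

Lemma dotvE (R : realType) n (v w : 'cV[R]_n) : dotv v w = (v^T *m w) 0 0.
Proof. by rewrite mxE; apply: eq_bigr => i _; rewrite mxE. Qed.

Lemma dotvC (R : realType) n (v w : 'cV[R]_n) : dotv v w = dotv w v.
Proof. by apply: eq_bigr => i _; rewrite mulrC. Qed.

Lemma dotvDr (R : realType) n (v w z : 'cV[R]_n) :
  dotv v (w + z) = dotv v w + dotv v z.
Proof. by rewrite !dotvE mulmxDr mxE. Qed.

Lemma dotvDl (R : realType) n (v w z : 'cV[R]_n) :
  dotv (w + z) v = dotv w v + dotv z v.
Proof. by rewrite dotvC dotvDr !(dotvC v). Qed.

Lemma dotvZr (R : realType) n (a : R) (v w : 'cV[R]_n) :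
  dotv v (a *: w) = a * dotv v w.
Proof. by rewrite !dotvE -scalemxAr mxE. Qed.

Lemma dotvZl (R : realType) n (a : R) (v w : 'cV[R]_n) :
  dotv (a *: v) w = a * dotv v w.
Proof. by rewrite dotvC dotvZr dotvC. Qed.

Lemma dotvNr (R : realType) n (v w : 'cV[R]_n) : dotv v (- w) = - dotv v w.
Proof. by rewrite -scaleN1r dotvZr mulN1r. Qed.

Lemma dotvBr (R : realType) n (v w z : 'cV[R]_n) :
  dotv v (w - z) = dotv v w - dotv v z.
Proof. by rewrite dotvDr dotvNr. Qed.

Lemma dotvBl (R : realType) n (v w z : 'cV[R]_n) :
  dotv (w - z) v = dotv w v - dotv z v.
Proof. by rewrite dotvC dotvBr !(dotvC v). Qed.

Lemma dotv_mulmxr (R : realType) m n (M : 'M[R]_(m, n)) (v : 'cV[R]_m) (w : 'cV[R]_n) :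
  dotv v (M *m w) = dotv (M^T *m v) w.
Proof. by rewrite !dotvE trmx_mul trmxK mulmxA. Qed.

Lemma dotv_ge0 (R : realType) n (v : 'cV[R]_n) : 0 <= dotv v v.
Proof. by apply: sumr_ge0 => i _; rewrite -expr2 sqr_ge0. Qed.

Lemma enorm_ge0 (R : realType) n (v : 'cV[R]_n) : 0 <= enorm v.
Proof. exact: sqrtr_ge0. Qed.

Lemma enorm_sqr (R : realType) n (v : 'cV[R]_n) : enorm v ^+ 2 = dotv v v.
Proof. by rewrite sqr_sqrtr// dotv_ge0. Qed.

Lemma enorm_eq0 (R : realType) n (v : 'cV[R]_n) : (enorm v == 0) = (v == 0).
Proof.
rewrite -sqrf_eq0 enorm_sqr psumr_eq0; last by move=> i _; rewrite -expr2 sqr_ge0.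
apply/allP/eqP => [v0|-> i _]; last by rewrite /= !mxE mul0r eqxx.
apply/colP => i; rewrite mxE; apply/eqP.
by rewrite -sqrf_eq0 expr2; have := v0 i (mem_index_enum i).
Qed.

Lemma enorm0 (R : realType) n : enorm (0 : 'cV[R]_n) = 0.
Proof. by apply/eqP; rewrite enorm_eq0. Qed.

Lemma enormZ (R : realType) n (a : R) (v : 'cV[R]_n) :
  enorm (a *: v) = `|a| * enorm v.
Proof.
by rewrite /enorm dotvZl dotvZr mulrA -expr2 sqrtrM ?sqr_ge0// sqrtr_sqr.
Qed.

(** Cauchy-Schwarz: the squared norm of [enorm w *: v - enorm v *: w] is 2 |v| |w| (|v| |w| - <v,
    w>), and the prefactor is positive for nonzero vectors. *)
Lemma dotv_le_enorm (R : realType) n (v w : 'cV[R]_n) :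
  dotv v w <= enorm v * enorm w.
Proof.
have [->|v0] := eqVneq v 0.
  by rewrite -(scale0r 0) dotvZl mul0r mulr_ge0// enorm_ge0.
have [->|w0] := eqVneq w 0.
  by rewrite -(scale0r 0) dotvZr mul0r mulr_ge0// enorm_ge0.
have a0 : 0 < enorm v by rewrite lt_def enorm_eq0 v0 enorm_ge0.
have b0 : 0 < enorm w by rewrite lt_def enorm_eq0 w0 enorm_ge0.
have := dotv_ge0 (enorm w *: v - enorm v *: w).
rewrite !dotvBl !dotvBr !dotvZl !dotvZr -!enorm_sqr (dotvC w v).
move: a0 b0; move: (enorm v) (enorm w) (dotv v w) => a b c a0 b0.
rewrite [leRHS](_ : _ = (a * b) * ((a * b - c) *+ 2)); last by ring.
by rewrite pmulr_rge0 ?mulr_gt0// pmulrn_lge0// subr_ge0.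
Qed.

Lemma ler_norm_dotv (R : realType) n (v w : 'cV[R]_n) :
  `|dotv v w| <= enorm v * enorm w.
Proof.
rewrite ler_norml dotv_le_enorm andbT lerNl -dotvNr.
by rewrite -[X in _ * X]mul1r -(normrN1 R) -enormZ scaleN1r dotv_le_enorm.
Qed.

Lemma ler_coord_enorm (R : realType) n (v : 'cV[R]_n) i : `|v i 0| <= enorm v.
Proof.
rewrite -(@ler_pXn2r _ 2)// ?nnegrE ?enorm_ge0// enorm_sqr real_normK ?num_real//.
rewrite /dotv (bigD1 i)//= expr2 lerDl.
by apply: sumr_ge0 => j _; rewrite -expr2 sqr_ge0.
Qed.

(** The Frobenius norm serves as [c], by Cauchy-Schwarz on each row. *)
Lemma enorm_mulmx_bounded (R : realType) m n (M : 'M[R]_(m, n)) :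
  exists2 c, 0 <= c & forall v, enorm (M *m v) <= c * enorm v.
Proof.
pose c := Num.sqrt (\sum_i enorm (row i M)^T ^+ 2).
have c0 : 0 <= \sum_i enorm (row i M)^T ^+ 2.
  by apply: sumr_ge0 => i _; exact: sqr_ge0.
exists c => [|v]; first exact: sqrtr_ge0.
rewrite -(@ler_pXn2r _ 2)// ?nnegrE ?mulr_ge0 ?sqrtr_ge0 ?enorm_ge0//.
rewrite enorm_sqr exprMn [c ^+ 2]sqr_sqrtr// mulr_suml; apply: ler_sum => i _.
have -> : (M *m v) i 0 = dotv (row i M)^T v.
  by rewrite mxE; apply: eq_bigr => j _; rewrite !mxE.
rewrite -expr2 -exprMn -ler_sqrt ?sqr_ge0// !sqrtr_sqr.
by rewrite [leRHS]ger0_norm ?mulr_ge0 ?enorm_ge0// ler_norm_dotv.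
Qed.

(** Ensures that [opnorm] is a true supremum and not the default value of [sup]. *)
Lemma opnorm_has_sup (R : realType) m n (M : 'M[R]_(m, n)) :
  has_sup [set enorm (M *m v) | v in [set v : 'cV[R]_n | enorm v <= 1]].
Proof.
have [c c0 Hc] := enorm_mulmx_bounded M; split.
  by exists (enorm (M *m 0)), 0; rewrite //= enorm0.
exists c => _ [v /= v1 <-]; apply: (le_trans (Hc v)).
by rewrite -[leRHS]mulr1 ler_wpM2l.
Qed.

Lemma opnorm_ge0 (R : realType) m n (M : 'M[R]_(m, n)) : 0 <= opnorm M.
Proof.
apply: (ub_le_sup (opnorm_has_sup M).2).
by exists 0; rewrite /= ?mulmx0 enorm0.
Qed.

Lemma enorm_mulmx_le (R : realType) m n (M : 'M[R]_(m, n)) (v : 'cV[R]_n) :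
  enorm (M *m v) <= opnorm M * enorm v.
Proof.
have [->|v0] := eqVneq v 0; first by rewrite mulmx0 !enorm0 mulr0.
have a0 : 0 < enorm v by rewrite lt_def enorm_eq0 v0 enorm_ge0.
rewrite -ler_pdivrMr//; apply: (ub_le_sup (opnorm_has_sup M).2).
exists ((enorm v)^-1 *: v) => /=.
  by rewrite enormZ ger0_norm ?invr_ge0 ?enorm_ge0// mulVf ?gt_eqF.
by rewrite -scalemxAr enormZ ger0_norm ?invr_ge0 ?enorm_ge0// mulrC.
Qed.

(** * Pointwise decay of the Lyapunov function *)

(** Coercivity forces every kernel vector to vanish. Hence [invmx P] in the observer is a genuine
    inverse. *)
Lemma posdefmx_unit (R : realType) n (P : 'M[R]_n) : posdefmx P -> P \in unitmx.
Proof.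
move=> [a a0 aP]; rewrite -unitmx_tr unitmxE unitfE; apply/negP => /det0P[v v0 vP].
have := aP v^T; rewrite -[P]trmxK -trmx_mul vP trmx0 -(scale0r 0) dotvZl mul0r.
rewrite pmulr_rle0// => v_le0.
have : enorm v^T == 0 by rewrite -sqrf_eq0 eq_le v_le0 sqr_ge0.
by rewrite enorm_eq0 -trmx0 (inj_eq trmx_inj) (negbTE v0).
Qed.

(** At [v = 0] both sides vanish whichever element of the unit ball is selected, so the selection
    does not matter. *)
Lemma Sign_dotv (R : realType) p (v s : 'cV[R]_p) :
  Sign v s -> dotv v s = enorm v.
Proof.
rewrite /Sign; case: eqVneq => [->|v0] /= sv.
  by rewrite -(scale0r 0) dotvZl mul0r scale0r enorm0.
by rewrite sv dotvZr -enorm_sqr expr2 mulKf// enorm_eq0.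
Qed.

(** The left side is V' at one instant: [v] and [vo] are values of the set-valued map, [G] and [Go]
    those of [f2] at [x] and [xo], and [H] that of [h] at [xo]. *)
Lemma lyapunov_rate (R : realType) n m p l (A P : 'M[R]_n) (B : 'M[R]_(n, m))
    (C : 'M[R]_(m, n)) (F : 'M[R]_(p, n)) (L : 'M[R]_(n, p)) (K : 'M[R]_(m, p))
    (H : 'M[R]_(l, p)) (G Go : 'M[R]_(n, l)) (x xo g go : 'cV[R]_n)
    (v vo : 'cV[R]_m) (s : 'cV[R]_p) (th : 'cV[R]_l) (L1 L2 L3 eps beta : R) :
  P^T = P -> posdefmx P ->
  negsemidefmx (P *m (A - L *m F) + (A - L *m F)^T *m P
                + (L1 + L2 * L3) *: (P *m P) + (L1 + L2 * L3)%:M + eps%:M) ->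
  B^T *m P = C - K *m F ->
  Go^T *m P = H *m F ->
  0 <= dotv (vo - v) ((C *m xo - K *m (F *m xo - F *m x)) - C *m x) ->
  enorm (go - g) <= L1 * enorm (xo - x) ->
  opnorm (Go - G) <= L2 * enorm (xo - x) ->
  0 <= L1 -> 0 <= L2 -> enorm th <= L3 -> L3 <= beta ->
  Sign (F *m xo - F *m x) s ->
  2 * dotv (P *m (xo - x))
        ((A *m xo + B *m - vo - L *m (F *m xo - F *m x) + go
          - (beta * opnorm H) *: (invmx P *m F^T *m s))
         - (A *m x + B *m - v + g + G *m th))
  <= - (eps * enorm (xo - x) ^+ 2).
Proof.
move=> PT Ppos lmi BP GP mono lip1 lip2 L1_ge0 L2_ge0 thL L3beta.
rewrite -!mulmxBr; set e := xo - x => /Sign_dotv sFe.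
have L3_ge0 : 0 <= L3 := le_trans (enorm_ge0 th) thL.
(* The unknown input is split into a Lipschitz part [(Go - G) *m th] and a part at [xo], where
   [Go^T *m P = H *m F] matches the sliding gain. *)
have -> : A *m xo + B *m - vo - L *m (F *m e) + go
      - (beta * opnorm H) *: (invmx P *m F^T *m s) - (A *m x + B *m - v + g + G *m th)
    = (A - L *m F) *m e - B *m (vo - v) + (go - g) + ((Go - G) *m th - Go *m th)
      - (beta * opnorm H) *: (invmx P *m (F^T *m s)).
  rewrite mulmxBl !mulmxA -[_ *m F *m e]mulmxA [A *m e]mulmxBr.
  rewrite [B *m (vo - v)]mulmxBr [(Go - G) *m th]mulmxBl !mulmxN !mulmxA.
  move: (A *m xo) (A *m x) (B *m vo) (B *m v) (L *m _) (Go *m th) (G *m th).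
  move: (_ *: _) => T a0 a1 b0 b1 c0 d0 d1.
  by apply/matrixP => i j; rewrite !mxE; ring.
have expand (w a b c d f z : 'cV[R]_n) k :
    dotv w (a - b + c + (d - f) - k *: z) =
    dotv w a - dotv w b + dotv w c + (dotv w d - dotv w f) - k * dotv w z.
  by rewrite !(dotvDr, dotvNr, dotvZr).
rewrite expand.
(* By symmetry [P] cancels [invmx P], leaving <Fe, s>, which is |Fe| by [sFe]. *)
have -> : dotv (P *m e) (invmx P *m (F^T *m s)) = enorm (F *m e).
  rewrite -{1}PT -dotv_mulmxr mulKVmx ?posdefmx_unit//.
  by rewrite dotv_mulmxr trmxK.
(* [B^T *m P *m e = (C - K *m F) *m e] is the difference of the two arguments at which [vo] and [v]
   are taken. *)
have monoe : 0 <= dotv (P *m e) (B *m (vo - v)).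
  rewrite dotv_mulmxr mulmxA BP mulmxBl dotvC.
  by move: mono; rewrite -mulmxBr -/e -mulmxA addrAC -mulmxBr.
have lip1e : dotv (P *m e) (go - g) <= enorm (P *m e) * (L1 * enorm e).
  by apply: (le_trans (dotv_le_enorm _ _)); rewrite ler_wpM2l ?enorm_ge0.
have lip2e : dotv (P *m e) ((Go - G) *m th) <= enorm (P *m e) * (L2 * enorm e * L3).
  apply: (le_trans (dotv_le_enorm _ _)); rewrite ler_wpM2l ?enorm_ge0//.
  apply: (le_trans (enorm_mulmx_le _ _)).
  by rewrite ler_pM ?opnorm_ge0 ?enorm_ge0.
have unce : - dotv (P *m e) (Go *m th) <= opnorm H * enorm (F *m e) * L3.
  rewrite dotv_mulmxr mulmxA GP -mulmxA -dotvNr.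
  apply: (le_trans (dotv_le_enorm _ _)).
  rewrite -scaleN1r enormZ normrN1 mul1r.
  by rewrite ler_pM ?enorm_ge0// enorm_mulmx_le.
have uncb : opnorm H * enorm (F *m e) * L3 <= beta * opnorm H * enorm (F *m e).
  rewrite mulrC -[leRHS]mulrA ler_wpM2r//.
  by rewrite mulr_ge0 ?opnorm_ge0 ?enorm_ge0.
have PD z : dotv (P *m z) e = dotv (P *m e) z.
  by rewrite dotvC dotv_mulmxr PT.
move: lmi; move: (A - L *m F) => ALF /(_ e).
have -> : dotv ((P *m ALF + ALF^T *m P + (L1 + L2 * L3) *: (P *m P)
    + (L1 + L2 * L3)%:M + eps%:M) *m e) e =
  2 * dotv (P *m e) (ALF *m e) + (L1 + L2 * L3) * enorm (P *m e) ^+ 2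
    + (L1 + L2 * L3) * enorm e ^+ 2 + eps * enorm e ^+ 2.
  rewrite !mulmxDl !dotvDl -!scalemxAl !mul_scalar_mx !dotvZl -!mulmxA.
  by rewrite !PD -dotv_mulmxr -!enorm_sqr mulr_natl mulr2n.
(* This square bounds the Lipschitz cross term 2 gamma |Pe| |e| by gamma (|Pe|^2 + |e|^2), the terms
   of the matrix inequality; the rest is linear. *)
have : 0 <= (L1 + L2 * L3) * (enorm (P *m e) - enorm e) ^+ 2.
  by rewrite mulr_ge0 ?sqr_ge0// addr_ge0// mulr_ge0.
move: monoe lip1e lip2e unce uncb; rewrite sqrrB -mulr_natl.
move: (dotv _ _) (dotv _ _) (dotv _ _) (dotv _ _) (dotv _ _) => *.
lra.
Qed.

(** * Derivatives of vector-valued curves *)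

Lemma is_derive_coord (R : realType) m n (f : R -> 'M[R]_(m, n)) (df : 'M[R]_(m, n))
    (t : R) i j :
  is_derive t 1 f df -> is_derive t 1 (fun x => f x i j) (df i j).
Proof.
move=> [dvf <-]; split; first by move/derivable_mxP : dvf.
by rewrite derive_mx// mxE.
Qed.

Lemma is_derive_dotv (R : realType) n (f g : R -> 'cV[R]_n) (df dg : 'cV[R]_n) (t : R) :
  is_derive t 1 f df -> is_derive t 1 g dg ->
  is_derive t 1 (fun x => dotv (f x) (g x)) (dotv df (g t) + dotv (f t) dg).
Proof.
move=> fdf gdg.
have -> : (fun x => dotv (f x) (g x)) =
    \sum_(i < n) ((fun x => f x i 0) * (fun x => g x i 0)).
  by apply/funext => x; rewrite fct_sumE.
have fgdfg : is_derive t 1 (\sum_(i < n) ((fun x => f x i 0) * (fun x => g x i 0)))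
    (\sum_(i < n) (f t i 0 *: dg i 0 + g t i 0 *: df i 0)).
  by apply: is_derive_sum => i; apply: is_deriveM; exact: is_derive_coord.
apply: is_derive_eq fgdfg _; rewrite /dotv -big_split/=; apply: eq_bigr => i _.
by rewrite addrC; congr (_ + _); rewrite mulrC.
Qed.

Lemma is_derive_mulmx (R : realType) m n (P : 'M[R]_(m, n)) (f : R -> 'cV[R]_n)
    (df : 'cV[R]_n) (t : R) :
  is_derive t 1 f df -> is_derive t 1 (fun x => P *m f x) (P *m df).
Proof.
move=> fdf.
have cdf i j : is_derive t 1 (fun x => (P *m f x) i j) ((P *m df) i j).
  have -> : (fun x => (P *m f x) i j) = \sum_(k < n) (P i k \*: (fun x => f x k j)).
    by apply/funext => x; rewrite fct_sumE mxE.
  rewrite mxE; apply: is_derive_sum => k.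
  exact: is_deriveZ (is_derive_coord _ _ fdf).
have dvPf : derivable (fun x => P *m f x) t 1.
  by apply/derivable_mxP => i j; case: (cdf i j).
split=> //; rewrite derive_mx//; apply/matrixP => i j; rewrite mxE.
by case: (cdf i j).
Qed.

(** * Closure properties of absolute continuity *)

Lemma ac_cst (R : realType) (a b c : R) : abs_continuous_real a b (fun=> c).
Proof.
move=> e e0; exists 1 => // k s t _ _.
by rewrite big1// => i _; rewrite subrr normr0.
Qed.

Lemma acD (R : realType) (a b : R) (f g : R -> R) :
  abs_continuous_real a b f -> abs_continuous_real a b g ->
  abs_continuous_real a b (fun x => f x + g x).
Proof.
move=> acf acg e e0; have e2 : 0 < e / 2 by rewrite divr_gt0.
have [d d0 Hd] := acf _ e2; have [d' d'0 Hd'] := acg _ e2.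
exists (Num.min d d'); first by rewrite lt_min d0.
move=> k s t st; rewrite lt_min => /andP[/(Hd _ _ _ st) lf /(Hd' _ _ _ st) lg].
rewrite (splitr e); apply: le_lt_trans (ltrD lf lg).
rewrite -big_split/=; apply: ler_sum => i _.
by rewrite opprD addrACA ler_normD.
Qed.

Lemma ac_sum (R : realType) (a b : R) n (f : 'I_n -> R -> R) :
  (forall i, abs_continuous_real a b (f i)) ->
  abs_continuous_real a b (fun x => \sum_(i < n) f i x).
Proof.
move=> acf; rewrite (_ : (fun x => _) = \sum_(i < n) f i); last first.
  by apply/funext => x; rewrite fct_sumE.
elim/big_ind : _ => //; first exact: ac_cst.
by move=> g h; exact: acD.
Qed.

(** Tolerance 1 with a single interval bounds the oscillation near each point, and real induction
    makes the bound global. *)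
Lemma ac_bounded (R : realType) (a b : R) (f : R -> R) :
  a <= b -> abs_continuous_real a b f ->
  exists M, forall x, a <= x -> x <= b -> `|f x| <= M.
Proof.
move=> ab acf.
pose Q x y := exists M, forall z, x <= z -> z <= y -> `|f z| <= M.
apply: (@straddle_ind R Q) => //.
- move=> x y z _ _ _ _ [M HM] [N HN]; exists (Num.max M N) => w xw wz.
  rewrite le_max; case: (leP w y) => wy; first by rewrite HM.
  by rewrite HN ?orbT// ltW.
- move=> s as_ sb; have [d d0 Hd] := acf 1 ltr01.
  have near u v : a <= u -> u <= v -> v <= b -> v - u < d -> `|f v - f u| < 1.
    move=> au uv vb vud.
    have := Hd 1%N (fun=> u) (fun=> v); rewrite !big_ord1; apply=> //.
    by split=> // i j; rewrite !ord1 eqxx.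
  exists d => // x y ax xs sy yb dx dy; exists (`|f s| + 1) => z xz zy.
  rewrite -[f z](subrK (f s)) addrC (le_trans (ler_normD _ _))// lerD2l ltW//.
  case: (leP z s) => zs; first by rewrite distrC near//; lra.
  by rewrite near//; lra.
Qed.

Lemma acM (R : realType) (a b : R) (f g : R -> R) :
  a <= b -> abs_continuous_real a b f -> abs_continuous_real a b g ->
  abs_continuous_real a b (fun x => f x * g x).
Proof.
move=> ab acf acg e e0.
have [M HM] := ac_bounded ab acf; have [N HN] := ac_bounded ab acg.
have M0 : 0 <= M by apply: le_trans (HM a _ _).
have N0 : 0 <= N by apply: le_trans (HN a _ _).
(* The increments of the product cost at most [M + N] times this tolerance, hence less than [e]; the
   1 keeps the denominator positive. *)
have e'0 : 0 < e / (M + N + 1) by rewrite divr_gt0//; lra.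
have [d d0 Hd] := acf _ e'0; have [d' d'0 Hd'] := acg _ e'0.
exists (Num.min d d'); first by rewrite lt_min d0.
move=> k s t st; rewrite lt_min => /andP[/(Hd _ _ _ st) lf /(Hd' _ _ _ st) lg].
set S := \sum_(i < k) `|f (t i) - f (s i)| in lf.
set T := \sum_(i < k) `|g (t i) - g (s i)| in lg.
have : M * T + N * S < e.
  have -> : e = M * (e / (M + N + 1)) + N * (e / (M + N + 1)) + e / (M + N + 1).
    by field; rewrite gt_eqF//; lra.
  rewrite (le_lt_trans (y := M * (e / (M + N + 1)) + N * (e / (M + N + 1))))//.
    by rewrite lerD// ler_wpM2l// ltW.
  by rewrite ltrDl.
apply: le_lt_trans; rewrite !mulr_sumr -big_split/=; apply: ler_sum => i _.
have [asi sti tib] := st.1 i.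
have -> : f (t i) * g (t i) - f (s i) * g (s i) =
  f (t i) * (g (t i) - g (s i)) + g (s i) * (f (t i) - f (s i)) by ring.
rewrite (le_trans (ler_normD _ _))// !normrM lerD// ler_wpM2r//.
  by apply: HM => //; exact: le_trans sti.
by apply: HN => //; exact: le_trans tib.
Qed.

Lemma lipschitz_ac (R : realType) (a b k : R) (f : R -> R) :
  (forall x y, a <= x -> x <= y -> y <= b -> `|f y - f x| <= k * (y - x)) ->
  abs_continuous_real a b f.
Proof.
move=> lipf e e0; have k0 : 0 < `|k| + 1 by rewrite ltr_wpDl.
exists (e / (`|k| + 1)); first by rewrite divr_gt0.
move=> l s t st; rewrite ltr_pdivlMr// mulrC mulr_sumr; apply: le_lt_trans.
apply: ler_sum => i _; have [asi sti tib] := st.1 i.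
apply: (le_trans (lipf _ _ asi sti tib)); rewrite ler_wpM2r ?subr_ge0//.
by rewrite (le_trans (ler_norm _))// lerDl.
Qed.

(** The inequality 1 + z <= exp z at z = c (x - y) bounds the increment by exp(c y) c (y - x), which
    gives a Lipschitz constant on the interval. *)
Lemma ac_expR (R : realType) (b c : R) :
  0 <= c -> abs_continuous_real 0 b (fun x => expR (c * x)).
Proof.
move=> c0; apply: (@lipschitz_ac _ _ _ (expR (c * b) * c)) => x y x0 xy yb.
rewrite ger0_norm ?subr_ge0 ?ler_expR ?ler_wpM2l//.
have -> : expR (c * x) = expR (c * y) * expR (c * (x - y)).
  by rewrite -expRD; congr expR; ring.
have := expR_ge1Dx (c * (x - y)).
rewrite -(ler_pM2l (expR_gt0 (c * y))) => H.
apply: (@le_trans _ _ (expR (c * y) * (c * (y - x)))); first by lra.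
by rewrite -mulrA ler_wpM2r ?ler_expR ?ler_wpM2l// mulr_ge0// subr_ge0.
Qed.

Lemma ac_coord (R : realType) n (f : R -> 'cV[R]_n) (b : R) i :
  0 < b -> abs_continuous_half_line f -> abs_continuous_real 0 b (fun x => f x i 0).
Proof.
move=> b0 acf e e0; have [d d0 Hd] := acf b b0 e e0.
exists d => // k s t [st dst] ltd; apply: le_lt_trans (Hd k s t st dst ltd).
apply: ler_sum => j _; have := ler_coord_enorm (f (t j) - f (s j)) i.
by rewrite !mxE.
Qed.

(** * Exponential decay of the observation error *)

Theorem theorem4 (R : realType) (n m p r l : nat)
  (A : 'M[R]_n) (B : 'M[R]_(n, m)) (C : 'M[R]_(m, n)) (F : 'M[R]_(p, n))
  (FF : 'cV[R]_m -> set 'cV[R]_m)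
  (f1 : 'cV[R]_n -> 'cV[R]_r -> 'cV[R]_n)
  (f2 : 'cV[R]_n -> 'cV[R]_r -> 'M[R]_(n, l))
  (theta : R -> 'cV[R]_l) (L1 L2 L3 eps : R)
  (P : 'M[R]_n) (L : 'M[R]_(n, p)) (K : 'M[R]_(m, p))
  (h : 'cV[R]_n -> 'cV[R]_r -> 'M[R]_(l, p)) (beta : R)
  (u : R -> 'cV[R]_r) (x xo : R -> 'cV[R]_n)
  (H1 : assumption1 FF)
  (H2 : assumption2 f1 f2 L1 L2)
  (H3 : assumption3 theta L3)
  (H4 : assumption4 A B C F f2 (L1 + L2 * L3) eps P L K h)
  (hbeta : L3 <= beta)
  (hx : plant_solution A B C FF f1 f2 theta u x)
  (hxo : observer_solution A B C F FF f1 P L K h beta u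
           (fun t => F *m x t) xo) :
  exists M c : R, [/\ 0 <= M, 0 < c &
    forall t : R, 0 <= t -> enorm (xo t - x t) <= M * expR (- (c * t))].
Proof.
have [FFmono _ _] := H1; have [_ _ L1_gt0 L2_gt0 lip] := H2; have [_ L3_gt0 thL] := H3.
have [eps_gt0 [PT Ppos] lmi BP GP] := H4; have [a a_gt0 Pa] := Ppos.
case: hx => acx [w aew]; case: hxo => acxo [wo [s aewo]].
have aeF : Filter (almost_everywhere (@lebesgue_measure R)).
  exact: (@ae_filter_ringOfSetsType _ (measurableTypeR R)).
(* The 1 keeps [b] positive even if [opnorm P] is zero; V <= b |e|^2 then turns the decay eps |e|^2
   into the rate [c = eps / b]. *)
pose b := opnorm P + 1; have b_gt0 : 0 < b by rewrite ltr_wpDl// opnorm_ge0.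
have Pb v : dotv (P *m v) v <= b * enorm v ^+ 2.
  apply: (le_trans (dotv_le_enorm _ _)); rewrite expr2 mulrA ler_wpM2r ?enorm_ge0//.
  apply: (le_trans (enorm_mulmx_le _ _)).
  by rewrite ler_wpM2r ?enorm_ge0// lerDl.
pose c := eps / b; have c_gt0 : 0 < c by rewrite divr_gt0.
pose e t := xo t - x t; pose V t := dotv (P *m e t) (e t).
pose W t := expR (c * t) * V t.
have V_ge0 t : 0 <= V t by apply: le_trans (Pa _); rewrite mulr_ge0 ?sqr_ge0// ltW.
have aeW : {ae lebesgue_measure, forall t : R, 0 <= t ->
    exists2 d, is_derive t 1 W d & d <= 0}.
  move: aew aewo; apply: filterS2 => t Hx Hxo t0.
  move: (Hx t0) => [[v FFv <-] dx]; have [[vo FFvo <-] Signs dxo] := Hxo t0.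
  have [lip1 lip2] := lip (xo t) (x t) (u t).
  have mono := FFmono _ _ _ _ FFvo FFv.
  have := lyapunov_rate PT Ppos lmi BP (GP (xo t) (u t)) mono lip1 lip2
    (ltW L1_gt0) (ltW L2_gt0) (thL t t0) hbeta Signs.
  have := is_deriveB dxo dx; rewrite -/(e t).
  set de := (X in is_derive _ _ _ X); rewrite -/de => dde rate.
  have dV : is_derive t 1 V (2 * dotv (P *m e t) de).
    apply: is_derive_eq (is_derive_dotv (is_derive_mulmx P dde) dde) _.
    by rewrite dotvC dotv_mulmxr PT mulr_natl mulr2n.
  have dE : is_derive t 1 (fun t => expR (c * t)) (expR (c * t) * c).
    apply: is_derive_eq (is_derive1_comp (f := expR) (g := c \*: id) _ _) _.
    by rewrite /GRing.scale/= mulr1.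
  exists (expR (c * t) * (2 * dotv (P *m e t) de + c * V t)).
    apply: is_derive_eq (is_deriveM dE dV) _.
    by rewrite /GRing.scale/=; ring.
  rewrite pmulr_rle0 ?expR_gt0//.
  have cV : c * V t <= eps * enorm (e t) ^+ 2.
    by rewrite /c mulrAC ler_pdivrMr// -mulrA ler_pM2l// mulrC Pb.
  by lra.
(* [V] is a polynomial in the coordinates of [e], so closure under sums and products suffices. *)
have acW t : 0 < t -> abs_continuous_real 0 t W.
  move=> t0.
  have ace i : abs_continuous_real 0 t (fun y => e y i 0).
    have -> : (fun y => e y i 0) = (fun y => xo y i 0 + -1 * x y i 0).
      by apply/funext => y; rewrite !mxE mulN1r.
    apply: acD; first exact: ac_coord.
    by apply: acM; [exact: ltW | exact: ac_cst | exact: ac_coord].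
  apply: acM; [exact: ltW | exact/ac_expR/ltW |].
  apply: ac_sum => i; apply: acM; [exact: ltW | | exact: ace].
  have -> : (fun y => (P *m e y) i 0) = (fun y => \sum_j P i j * e y j 0).
    by apply/funext => y; rewrite mxE.
  apply: ac_sum => j.
  by apply: acM; [exact: ltW | exact: ac_cst | exact: ace].
(* From a |e|^2 <= V and [W t <= W 0] follows |e|^2 <= (V 0 / a) exp(-c t); the square root gives
   the constant and halves the rate. *)
exists (Num.sqrt (V 0 / a)), (c / 2); split; [exact: sqrtr_ge0 | by rewrite divr_gt0 |].
move=> t t0.
have WtW0 : W t <= W 0.
  (* The time 0 is set apart because absolute continuity is given on intervals of positive
     length. *)
  move: t0; rewrite le_eqVlt => /predU1P[<-//|t0].
  apply: (ac_nonincreasing (ltW t0) (acW t t0)).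
  by move: aeW; apply: filterS => y Hy y0 _; exact: Hy.
rewrite -(@ler_pXn2r _ 2)// ?nnegrE ?mulr_ge0 ?enorm_ge0 ?sqrtr_ge0 ?expR_ge0//.
rewrite exprMn [Num.sqrt (V 0 / a) ^+ 2]sqr_sqrtr; last by rewrite divr_ge0// ltW.
rewrite -expRM_natl mulrN mulrA.
have -> : 2 * (c / 2) = c by field.
rewrite mulrAC ler_pdivlMr// mulrC (le_trans (Pa _))//.
rewrite expRN ler_pdivlMr ?expR_gt0// mulrC.
by move: WtW0; rewrite /W mulr0 expR0 mul1r.
Qed.
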